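(* Let $\mathcal H$ be a cluster of graphs with anchor $H$, and suppose that $\mathrm{gen}(H)<\mathrm{gen}(\bigcup\mathcal H)$. Then there is a subcollection $\overline{\mathcal H}\subseteq\mathcal H$ with $H\in\overline{\mathcal H}$ and $|\overline{\mathcal H}|\le 5$ such that $\mathrm{gen}(H)<\mathrm{gen}(\bigcup\overline{\mathcal H})$.
   Context: All surfaces are compact and orientable; $\Sigma_g$ denotes the one of genus $g$. A cluster of graphs is a finite collection $\mathcal H$ of pairwise edge-disjoint connected graphs simultaneously embedded in one surface, such that some $H\in\mathcal H$ (an anchor) shares at least one vertex with every graph in $\mathcal H$. For a subfamily $\mathcal F$, $\bigcup\mathcal F$ is the embedded graph that is the union of its members. The rotation at a vertex of an embedded graph is the clockwise cyclic order of its incident edges; two embedded graphs are isomorphic if there is an isomorphism of the underlying abstract graphs mapping rotations to rotations. The genus $\mathrm{gen}(G)$ of an embedded graph $G$ is the least $g$ such that $G$ is isomorphic (as an embedded graph) to a graph embedded in $\Sigma_g$; for connected $G$ with vertex set $V$, edge set $E$ and set of facial walks $\mathcal W$, $\mathrm{gen}(G)=\tfrac12(2-|V|+|E|-|\mathcal W|)$. *)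

(* Defs.v *)
From HB Require Import structures.
From mathcomp Require Import all_boot.
From mathcomp Require classical_sets.

Set Implicit Arguments.
Unset Strict Implicit.
Unset Printing Implicit Defensive.

(** Embedded graphs are only ever considered up to isomorphisms preserving the
    rotations, so an embedded graph is represented by its rotation system.
    Every edge is a pair of opposite darts exchanged by [rev]; loops, parallel
    edges and isolated vertices are allowed.  [rotation v] lists the darts
    leaving [v] in clockwise order; only its cyclic order is meaningful. *)
Record embedded_graph := EmbeddedGraph {
  vertex : finType;
  dart : finType;
  tail : dart -> vertex;
  rev : dart -> dart;
  rotation : vertex -> seq dart;
  revK : involutive rev;
  rev_neq : forall d, rev d != d;
  rotation_uniq : forall v, uniq (rotation v);
  mem_rotation : forall v d, (d \in rotation v) = (tail d == v)
}.

Arguments tail {e} d.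
Arguments rev {e} d.
Arguments rotation {e} v.

Section EmbeddedGraphTheory.
Variable G : embedded_graph.

Definition adjacent : rel (vertex G) :=
  fun u v => [exists d : dart G, (tail d == u) && (tail (rev d) == v)].

Definition connected : Prop :=
  0 < #|vertex G| /\ forall u v : vertex G, connect adjacent u v.

Definition n_edges : nat := #|dart G|./2.

Definition face_next (d : dart G) : dart G :=
  next (rotation (tail (rev d))) (rev d).

(** An isolated vertex carries no dart, but contributes one trivial facial
    walk. *)
Definition n_facial_walks : nat :=
  fcard face_next predT + #|[pred v : vertex G | rotation v == [::]]|.

(** A connected rotation system is a cellular embedding, in a closed
    orientable surface whose genus [g] is determined by Euler's formula
    |V| - |E| + |W| = 2 - 2g. *)
Definition cellular_in (g : nat) : Prop :=
  connected /\ #|vertex G| + n_facial_walks + 2 * g = n_edges + 2.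

Definition is_subgraph (p : {set vertex G} * {set dart G}) : bool :=
  [forall d in p.2, (rev d \in p.2) && (tail d \in p.1)].

Record subgraph := Subgraph {
  subgraph_val : {set vertex G} * {set dart G};
  _ : is_subgraph subgraph_val
}.

HB.instance Definition _ := [isSub for subgraph_val].
HB.instance Definition _ := [Finite of subgraph by <:].

Definition vset (S : subgraph) : {set vertex G} := (val S).1.
Definition dset (S : subgraph) : {set dart G} := (val S).2.

Lemma rev_dset (S : subgraph) d : d \in dset S -> rev d \in dset S.
Proof. by case: S => p Sp /(forall_inP Sp)/andP[]. Qed.

Lemma tail_vset (S : subgraph) d : d \in dset S -> tail d \in vset S.
Proof. by case: S => p Sp /(forall_inP Sp)/andP[]. Qed.

(** A subgraph as an embedded graph: each rotation is obtained from the
    ambient one by erasing the darts that are not in the subgraph. *)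
Section EmbeddedSubgraph.
Variable S : subgraph.

Let sub_vertex : finType := {v : vertex G | v \in vset S}.
Let sub_dart : finType := {d : dart G | d \in dset S}.

Definition sub_tail (d : sub_dart) : sub_vertex :=
  exist _ (tail (val d)) (tail_vset (valP d)).

Definition sub_rev (d : sub_dart) : sub_dart :=
  exist _ (rev (val d)) (rev_dset (valP d)).

Definition sub_rotation (v : sub_vertex) : seq sub_dart :=
  pmap insub (rotation (val v)).

Lemma sub_revK : involutive sub_rev.
Proof. by move=> d; apply: val_inj; rewrite /= revK. Qed.

Lemma sub_rev_neq d : sub_rev d != d.
Proof. by rewrite -val_eqE /= rev_neq. Qed.

Lemma sub_rotation_uniq v : uniq (sub_rotation v).
Proof. exact/pmap_sub_uniq/rotation_uniq. Qed.

Lemma mem_sub_rotation v d : (d \in sub_rotation v) = (sub_tail d == v).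
Proof. by rewrite mem_pmap_sub mem_rotation -val_eqE. Qed.

Definition embedded_subgraph : embedded_graph :=
  EmbeddedGraph sub_revK sub_rev_neq sub_rotation_uniq mem_sub_rotation.

End EmbeddedSubgraph.

Lemma union_is_subgraph (F : {set subgraph}) :
  is_subgraph (\bigcup_(S in F) vset S, \bigcup_(S in F) dset S).
Proof.
apply/forall_inP => d /bigcupP[S FS dS]; apply/andP; split; apply/bigcupP.
  by exists S; last exact: rev_dset.
by exists S; last exact: tail_vset.
Qed.

Definition union_subgraph (F : {set subgraph}) : subgraph := Subgraph (union_is_subgraph F).

End EmbeddedGraphTheory.

Coercion embedded_subgraph : subgraph >-> embedded_graph.

(** Clockwise order is mapped to clockwise order; [rot k] accounts for the
    choice of a first dart in the list representing a cyclic order. *)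
Definition isomorphic (G G' : embedded_graph) : Prop :=
  exists (f : vertex G -> vertex G') (h : dart G -> dart G'),
    [/\ bijective f, bijective h,
        forall d, tail (h d) = f (tail d),
        forall d, rev (h d) = h (rev d)
      & forall v, exists k, rotation (f v) = rot k (map h (rotation v))].

(** [G] is isomorphic to a graph embedded in the closed orientable surface of
    genus [g].  The embedding need not be cellular: the graphs embedded in that
    surface are the subgraphs of the graphs cellularly embedded in it, because
    any embedded graph can be extended to a cellularly embedded one. *)
Definition embeddable_in (G : embedded_graph) (g : nat) : Prop :=
  exists (M : embedded_graph) (S : subgraph M),
    cellular_in M g /\ isomorphic G S.

(** The least [g] such that [embeddable_in G g]; one exists for every [G]. *)
Definition gen (G : embedded_graph) : nat :=
  classical_sets.xget 0 (fun g : nat =>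
    embeddable_in G g /\ forall k, embeddable_in G k -> g <= k).

Section Clusters.
Variable M : embedded_graph.

Definition is_anchor (HH : {set subgraph M}) (H : subgraph M) : Prop :=
  H \in HH /\ forall A, A \in HH -> vset H :&: vset A != set0.

Definition is_cluster (HH : {set subgraph M}) : Prop :=
  [/\ forall A, A \in HH -> connected A,
      forall A B, A \in HH -> B \in HH -> A != B -> [disjoint dset A & dset B]
    & exists H, is_anchor HH H].

End Clusters.

(* Main.v *)
Require Import Defs.
From mathcomp Require Import all_boot all_order all_algebra.
From mathcomp Require Import ring lra zify.
From mathcomp Require classical_sets.

(** Every connected embedded graph carries an alternating form [omega] on its
    rational cycle space, the intersection form of the surface obtained by
    thickening the graph.  Its radical is spanned by the face boundaries, so by
    Euler's formula its rank is twice the genus; and it is defined locally from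
    the rotations, so the form of a subgraph is the restriction of the form of
    the ambient graph.

    Since each member of a cluster is connected and meets the anchor [H], the
    cycles of the union are spanned by the cycles lying in [H] and two further
    members: cut a closed walk at the passages from one member to another and
    join each cut point to a base point of [H] inside both members.  If the rank
    on the union exceeds the rank on [H], then the part of the form orthogonal
    to [H] is nonzero on some pair of spanning cycles, and these involve at most
    four members besides [H]. *)

Set Implicit Arguments.
Unset Strict Implicit.
Unset Printing Implicit Defensive.

Import GRing.Theory Num.Theory.

Local Notation rev := Defs.rev.
Local Notation revK := Defs.revK.

(** * Antisymmetric double sums along a list *)

Section Wedge.
Local Open Scope ring_scope.

(** The sum over [i < j] of [x l_i * y l_j - y l_i * x l_j]. *)
Fixpoint wedge (T : Type) (x y : T -> rat) (l : seq T) : rat :=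
  if l is d :: l' then
    x d * (\sum_(e <- l') y e) - y d * (\sum_(e <- l') x e) + wedge x y l'
  else 0.

Lemma wedge_cat (T : Type) (x y : T -> rat) l1 l2 :
  wedge x y (l1 ++ l2) = wedge x y l1 + wedge x y l2
    + (\sum_(e <- l1) x e) * (\sum_(e <- l2) y e)
    - (\sum_(e <- l1) y e) * (\sum_(e <- l2) x e).
Proof.
elim: l1 => [|d l1 IH] /=; first by rewrite !big_nil; ring.
by rewrite IH !big_cat !big_cons /=; ring.
Qed.

(** Moving a prefix to the end reverses the sign of the cross term in [wedge_cat]. That term is
    zero, because both sums over the prefix are the negatives of the sums over the rest. *)
Lemma wedge_rot (T : Type) (x y : T -> rat) k l :
  \sum_(e <- l) x e = 0 -> \sum_(e <- l) y e = 0 ->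
  wedge x y (rot k l) = wedge x y l.
Proof.
rewrite -{1 2 4}(cat_take_drop k l) /rot !wedge_cat !big_cat /=.
by move=> /eqP; rewrite addr_eq0 => /eqP -> /eqP; rewrite addr_eq0 => /eqP ->; ring.
Qed.

Lemma wedge_map (T U : Type) (h : T -> U) (x y : U -> rat) l :
  wedge x y (map h l) = wedge (x \o h) (y \o h) l.
Proof. by elim: l => //= d l ->; rewrite !big_map. Qed.

Lemma eq_wedge (T : Type) (x x' y y' : T -> rat) l :
  x =1 x' -> y =1 y' -> wedge x y l = wedge x' y' l.
Proof.
move=> xx yy; elim: l => //= d l ->.
rewrite xx yy (eq_bigr y' (fun e _ => yy e)).
by rewrite (eq_bigr x' (fun e _ => xx e)).
Qed.

Lemma sum_pmap_insub (T : Type) (P : pred T) (U : subType P) (x : T -> rat) l :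
  (forall d, ~~ P d -> x d = 0) ->
  \sum_(e <- pmap (insub : T -> option U) l) x (val e) = \sum_(e <- l) x e.
Proof.
move=> x0; elim: l => [|d l IH] /=; first by rewrite !big_nil.
rewrite big_cons; case: insubP => [u _ <-|/x0->] /=; last by rewrite add0r.
by rewrite big_cons IH.
Qed.

(** An entry on which both functions vanish contributes to no product. Hence the rotations of a
    subgraph, obtained by erasing darts, give the same sums as the ambient ones. *)
Lemma wedge_pmap_insub (T : Type) (P : pred T) (U : subType P) (x y : T -> rat) l :
  (forall d, ~~ P d -> x d = 0) -> (forall d, ~~ P d -> y d = 0) ->
  wedge (x \o val) (y \o val) (pmap (insub : T -> option U) l) = wedge x y l.
Proof.
move=> x0 y0; elim: l => [|d l IH] //=.
case: insubP => [u _ <-|Pd] /=; last by rewrite x0 // y0 // IH; ring.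
by rewrite IH !sum_pmap_insub.
Qed.

Lemma wedgeC (T : Type) (x y : T -> rat) l : wedge y x l = - wedge x y l.
Proof. by elim: l => [|d l IH] /=; rewrite ?oppr0 // IH; ring. Qed.

Lemma wedge_linear (T : Type) (I : finType) (a : I -> rat) (x : I -> T -> rat) z y l :
  (forall d, z d = \sum_i a i * x i d) ->
  wedge z y l = \sum_i a i * wedge (x i) y l.
Proof.
move=> zE; elim: l => [|d l IH] /=.
  by rewrite big1 // => i _; rewrite mulr0.
rewrite IH (eq_bigr _ (fun e _ => zE e)) exchange_big zE /=.
rewrite mulr_suml mulr_sumr -sumrB -big_split /=; apply: eq_bigr => i _.
by rewrite -mulr_sumr; ring.
Qed.

(** Discrete integration by parts. *)
Lemma wedge_potential (T : eqType) (f : T -> T) (X x y : T -> rat) d l :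
  fpath f d l -> (forall e, x e = X (f e) - X e) ->
  wedge x y (d :: l) = \sum_(e <- d :: l) y e * (X e + X (f e))
    - (X d + X (f (last d l))) * \sum_(e <- d :: l) y e.
Proof.
move=> fl xE.
have sumx d' l' : fpath f d' l' -> \sum_(e <- l') x e = X (f (last d' l')) - X (f d').
  elim: l' d' => [|e l' IH] d' /=; first by rewrite big_nil subrr.
  by case/andP=> /eqP-> /IH; rewrite big_cons xE => ->; ring.
elim: l d fl => [|e l IH] d; first by move=> _; rewrite /= !big_nil !big_cons !big_nil xE; ring.
move=> fl; have := fl; rewrite [path _ _ _]/= => /andP[/eqP fd fe].
have ws : wedge x y [:: d, e & l] = x d * (\sum_(e <- e :: l) y e) -
    y d * (\sum_(e <- e :: l) x e) + wedge x y (e :: l) by [].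
rewrite ws IH // (sumx _ _ fl) xE ![\sum_(_ <- [:: d, e & l]) _]big_cons fd.
set s := \sum_(_ <- _) _; set t := \sum_(_ <- _) _; rewrite /=.
by ring.
Qed.

End Wedge.

(** * Cycles of an embedded graph and their intersection form *)

Section Form.
Local Open Scope ring_scope.
Variable G : embedded_graph.
Implicit Types (x y z : dart G -> rat) (D : {set dart G}).

(** Chains are antisymmetric functions on darts, so each edge has one free value. The support
    condition keeps the cycles of all subgraphs inside one space. *)
Definition cycle_in D x :=
  [/\ forall d, x (rev d) = - x d,
      forall v, \sum_(d | tail d == v) x d = 0
    & forall d, d \notin D -> x d = 0].

(** Independent, on cycles, of where each cyclic order is cut open
    ([wedge_rot]). *)
Definition omega x y : rat := \sum_(v : vertex G) wedge x y (rotation v).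

(** The rank of [omega] on the cycles supported in [D] is at least [k]; this
    form of the statement is visibly monotone in [D]. *)
Definition has_pairing D (k : nat) :=
  exists x y : 'I_k -> dart G -> rat,
    [/\ forall i, cycle_in D (x i), forall i, cycle_in D (y i)
      & forall i j, omega (x i) (y j) = (i == j)%:R].

Lemma sum_rotation x v : \sum_(d <- rotation v) x d = \sum_(d | tail d == v) x d.
Proof.
rewrite big_uniq ?rotation_uniq //.
by apply: eq_bigl => d; rewrite mem_rotation.
Qed.

Lemma sum_tail x : \sum_d x d = \sum_v \sum_(d <- rotation v) x d.
Proof.
rewrite (partition_big tail predT) //=.
by apply: eq_bigr => v _; rewrite sum_rotation.
Qed.

Lemma omegaC x y : omega y x = - omega x y.
Proof. by rewrite /omega -sumrN; apply: eq_bigr => v _; rewrite wedgeC. Qed.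

Lemma omega_linear (I : finType) (a : I -> rat) (x : I -> dart G -> rat) z y :
  (forall d, z d = \sum_i a i * x i d) ->
  omega z y = \sum_i a i * omega (x i) y.
Proof.
move=> zE; rewrite /omega (eq_bigr _ (fun v _ => wedge_linear y (rotation v) zE)).
by rewrite exchange_big; apply: eq_bigr => i _; rewrite mulr_sumr.
Qed.

Lemma omega_linear_r (I : finType) (a : I -> rat) (x : I -> dart G -> rat) z y :
  (forall d, z d = \sum_i a i * x i d) ->
  omega y z = \sum_i a i * omega y (x i).
Proof.
move=> zE; rewrite omegaC (omega_linear y zE) -sumrN.
by apply: eq_bigr => i _; rewrite (omegaC y) mulrN opprK.
Qed.

Lemma cycle_in_linear D (I : finType) (a : I -> rat) (x : I -> dart G -> rat) z :
  (forall i, cycle_in D (x i)) -> (forall d, z d = \sum_i a i * x i d) ->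
  cycle_in D z.
Proof.
move=> xZ zE; split=> [d|v|d dD].
- by rewrite !zE -sumrN; apply: eq_bigr => i _; case: (xZ i) => -> _ _; rewrite mulrN.
- rewrite (eq_bigr _ (fun d _ => zE d)) exchange_big big1 // => i _.
  by rewrite -mulr_sumr; case: (xZ i) => _ -> _; rewrite mulr0.
- by rewrite zE big1 // => i _; case: (xZ i) => _ _ ->; rewrite ?mulr0.
Qed.

Lemma cycle_inS D D' x : D \subset D' -> cycle_in D x -> cycle_in D' x.
Proof.
by move=> /subsetP DD' [xN x0 xD]; split=> // d dD'; apply: xD; apply: contra dD'; exact: DD'.
Qed.

Lemma has_pairingS D D' k : D \subset D' -> has_pairing D k -> has_pairing D' k.
Proof.
by move=> DD' [x [y [xZ yZ xy]]]; exists x, y; split=> // i; apply: (cycle_inS DD').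
Qed.

(** All rotations as one permutation of the darts: its orbits are the vertices that carry darts, and
    applying it after [rev] gives [face_next]. *)
Definition sigma (d : dart G) : dart G := next (rotation (tail d)) d.

Lemma tail_sigma d : tail (sigma d) = tail d.
Proof. by apply/eqP; rewrite -mem_rotation mem_next mem_rotation. Qed.

Lemma sigma_inj : injective sigma.
Proof.
move=> d e de; have te : tail d = tail e by rewrite -tail_sigma de tail_sigma.
move: de; rewrite /sigma te; apply: can_inj (prev_next (rotation_uniq _)) _ _.
Qed.

Lemma face_nextE d : face_next d = sigma (rev d). Proof. by []. Qed.

Lemma sum_rotation_sigma x v :
  \sum_(d <- rotation v) x (sigma d) = \sum_(d <- rotation v) x d.
Proof.
rewrite !sum_rotation [RHS](reindex_inj sigma_inj).
by apply: eq_bigl => d; rewrite tail_sigma.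
Qed.

(** Integration by parts at a vertex leaves a boundary term that multiplies the sum of [y] around
    the vertex, which is zero for a cycle. *)
Lemma omega_potential D x y (X : dart G -> rat) :
  cycle_in D y -> (forall d, x d = X (sigma d) - X d) ->
  omega x y = \sum_d y d * (X d + X (sigma d)).
Proof.
case=> _ y0 _ xE; rewrite sum_tail; apply: eq_bigr => v _.
case Ev: (rotation v) (cycle_next (rotation_uniq v)) => [|d l] /=.
  by rewrite big_nil.
rewrite rcons_path -/(fpath _ _ _) => /andP[dl _].
have fdl : fpath sigma d l.
  suff : {in d :: l, next (d :: l) =1 sigma}.
    move: dl; set f := next _ => dl fE.
    rewrite (@eq_in_path _ (mem (d :: l)) _ (frel f)) //; last exact/allP.
    by move=> a b aP bP; rewrite /= fE.
  move=> e; rewrite -Ev mem_rotation => /eqP te; by rewrite /sigma te.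
rewrite -/(wedge x y (d :: l)) (wedge_potential y fdl xE).
by rewrite -Ev (sum_rotation y) y0 mulr0 subr0.
Qed.

End Form.

(** * Duality and ranks of matrices over a field *)

Section LinearAlgebra.
Local Open Scope ring_scope.
Variable F : fieldType.

(** The columns of [cokermx B] are killed by [B], hence by [A], and this vanishing characterises
    inclusion of row spaces. *)
Lemma submx_col_ker m1 m2 n (A : 'M[F]_(m1, n)) (B : 'M[F]_(m2, n)) :
  (forall c : 'cV_n, B *m c = 0 -> A *m c = 0) -> (A <= B)%MS.
Proof.
move=> BA; rewrite submxE; apply/eqP/matrixP => i j.
have /BA AC0 : B *m col j (cokermx B) = 0.
  by rewrite colE mulmxA mulmx_coker mul0mx.
transitivity ((A *m col j (cokermx B)) i 0); last by rewrite AC0 !mxE.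
by rewrite colE mulmxA -colE [RHS]mxE.
Qed.

(** A row space is its own double orthogonal: the rows of [kermx A^T] span the orthogonal of the
    rows of [A]. *)
Lemma sub_ker_tr m n (A : 'M[F]_(m, n)) (c : 'cV_n) :
  kermx A^T *m c = 0 -> (c^T <= A)%MS.
Proof.
move=> Kc; rewrite submxE -trmx_eq0 trmx_mul trmxK.
have /submxP[D ->] : ((cokermx A)^T <= kermx A^T)%MS.
  by apply/sub_kermxP; rewrite -trmx_mul mulmx_coker trmx0.
by rewrite -mulmxA Kc mulmx0.
Qed.

Lemma row_mul_col m n p (A : 'M[F]_(m, n)) (B : 'M_(n, p)) i j :
  (row i A *m col j B) 0 0 = (A *m B) i j.
Proof. by rewrite !mxE; apply: eq_bigr => k _; rewrite !mxE. Qed.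

(** The column kernel of [W] is the space of functions constant on the fibers of a surjection, so
    its dimension is the number of fibers. This turns counts of vertices and of orbits into
    ranks. *)
Lemma rank_fibers m n (W : 'M[F]_(m, n)) (T : finType) (pi : 'I_n -> T) :
  (forall t, exists i, pi i = t) ->
  (forall c : 'cV_n, W *m c = 0 <-> forall i j, pi i = pi j -> c i 0 = c j 0) ->
  (\rank W + #|T| = n)%N.
Proof.
move=> /fin_all_exists[s sK] WP.
(* The rows of [N] are the indicator functions of the fibers; the chosen points [s t] provide a
   right inverse. *)
pose N : 'M[F]_(#|T|, n) := \matrix_(t, i) (pi i == enum_val t)%:R.
have NK : N *m (\matrix_(i, t) (i == s (enum_val t))%:R) = 1%:M.
  apply/matrixP => t u; rewrite !mxE (bigD1 (s (enum_val u))) //= !mxE sK eqxx mulr1.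
  rewrite big1 ?addr0 ?(inj_eq enum_val_inj) 1?eq_sym //.
  by move=> i /negPf iu; rewrite !mxE iu mulr0.
have rN : \rank N = #|T| by apply/eqP/row_freeP; exists (\matrix_(i, t) (i == s (enum_val t))%:R).
suff /eqmx_rank : (kermx W^T == N)%MS.
  by rewrite rN mxrank_ker mxrank_tr => <-; rewrite subnKC ?rank_leq_col.
apply/andP; split; apply/row_subP => i.
  have : row i (kermx W^T) *m W^T = 0 by rewrite -row_mul mulmx_ker row0.
  move: (row i _) => u /(congr1 trmx); rewrite trmx_mul trmxK trmx0 => /WP uP.
  apply/submxP; exists (\row_t u 0 (s (enum_val t))); apply/rowP => j.
  rewrite !mxE (bigD1 (enum_rank (pi j))) //= !mxE enum_rankK eqxx mulr1.
  rewrite big1 ?addr0 => [|t tj].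
    by have := uP j (s (pi j)); rewrite sK !mxE => ->.
  rewrite !mxE; case: eqP => [pj|]; last by rewrite mulr0.
  by rewrite pj enum_valK eqxx in tj.
apply/sub_kermxP/trmx_inj; rewrite trmx_mul trmxK trmx0; apply/WP => j k jk.
by rewrite !mxE jk.
Qed.

(** A full-rank factorisation compresses [A] to an invertible antisymmetric matrix [B] of size [r].
    Then [\det B = (-1)^r * \det B] excludes odd [r]. *)
Lemma antisym_rank_even n (A : 'M[F]_n) :
  2%:R != 0 :> F -> A^T = - A -> ~~ odd (\rank A).
Proof.
move=> two AT; have AE := mulmx_base A.
move: (col_base A) (row_base A) (col_base_full A) (row_base_free A) AE.
set r := \rank A => C R /row_fullP[P PC] Rfree AE.
pose B := P *m A *m P^T.
have BR : B = R *m P^T by rewrite /B -AE mulmxA PC mul1mx.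
have BT : B^T = - B by rewrite /B !trmx_mul trmxK AT mulNmx mulmxN mulmxA.
have RB : R = B *m C^T.
  have : P *m A^T = - R by rewrite AT mulmxN -AE mulmxA PC mul1mx.
  rewrite -AE trmx_mul mulmxA => /(congr1 (fun X => - X)); rewrite opprK => <-.
  by rewrite -mulNmx; congr (_ *m _); rewrite -[P *m R^T]trmxK trmx_mul trmxK -BR BT opprK.
have Bunit : B \in unitmx.
  rewrite -row_free_unit /row_free eqn_leq rank_leq_row /=.
  by rewrite -[X in (X <= _)%N](eqP Rfree) RB mxrankM_maxl.
apply/negP => rodd; have := congr1 determinant BT.
rewrite det_tr -scaleN1r detZ -signr_odd rodd expr1 mulN1r => /eqP.
rewrite -addr_eq0 -mulr2n -mulr_natl mulf_eq0 (negPf two) /= => /eqP d0.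
by move: Bunit; rewrite unitmxE d0 unitr0.
Qed.

End LinearAlgebra.

(** * Functions on a finite type as row vectors, and composition with a self-map *)

Section Pullback.
Local Open Scope ring_scope.
Variable T : finType.
Implicit Types (f : T -> T) (x X : T -> rat).
Local Notation n := #|T|.

Definition vec x : 'rV[rat]_n := \row_j x (enum_val j).
Definition fn (v : 'rV[rat]_n) : T -> rat := fun d => v 0 (enum_rank d).
(** Acts on row vectors, as composition with [f] on the right. *)
Definition pull f : 'M[rat]_n := \matrix_(i, j) (enum_val i == f (enum_val j))%:R.

Lemma fnK v : vec (fn v) = v.
Proof. by apply/rowP => j; rewrite mxE /fn enum_valK. Qed.

Lemma vecK x d : fn (vec x) d = x d.
Proof. by rewrite /fn mxE enum_rankK. Qed.

Lemma fn_mul_pull v f d : fn (v *m pull f) d = fn v (f d).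
Proof.
rewrite /fn mxE (bigD1 (enum_rank (f d))) //= !mxE !enum_rankK eqxx mulr1.
rewrite big1 ?addr0 // => i id; rewrite !mxE enum_rankK.
case: eqP => [E|]; last by rewrite mulr0.
by rewrite -E enum_valK eqxx in id.
Qed.

Lemma fn_inj v w : fn v =1 fn w -> v = w.
Proof. by move=> vw; rewrite -[v]fnK -[w]fnK; apply/rowP => j; rewrite !mxE. Qed.

Lemma fnD v w d : fn (v + w) d = fn v d + fn w d.
Proof. by rewrite /fn mxE. Qed.

Lemma fnB v w d : fn (v - w) d = fn v d - fn w d.
Proof. by rewrite /fn !mxE. Qed.

Lemma dot_vec (v w : 'rV[rat]_n) : (v *m w^T) 0 0 = \sum_d fn w d * fn v d.
Proof.
rewrite mxE [RHS](reindex _ (onW_bij _ (enum_val_bij T))) /=.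
by apply: eq_bigr => j _; rewrite mxE /fn !enum_valK mulrC.
Qed.

Lemma sub_pull_sub1 f v :
  (v <= pull f - 1%:M)%MS <-> exists X, forall d, fn v d = X (f d) - X d.
Proof.
split=> [/submxP[u ->]|[X vE]].
  by exists (fn u) => d; rewrite mulmxBr mulmx1 fnB fn_mul_pull.
apply/submxP; exists (vec X); apply: fn_inj => d.
by rewrite vE mulmxBr mulmx1 fnB fn_mul_pull !vecK.
Qed.

Lemma ker_pull_sub1 f (u : 'rV[rat]_n) : u *m (pull f - 1%:M) = 0 <-> forall d, fn u (f d) = fn u d.
Proof.
rewrite mulmxBr mulmx1; split=> [/eqP|uf].
  by rewrite subr_eq0 => /eqP uf d; rewrite -fn_mul_pull uf.
by apply/eqP; rewrite subr_eq0; apply/eqP/fn_inj => d; rewrite fn_mul_pull.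
Qed.

(** On columns, [pull f] acts as composition with the inverse of [f], whence the injectivity; the
    invariant functions are the same. *)
Lemma colker_pull_sub1 f (c : 'cV[rat]_n) : injective f ->
  (pull f - 1%:M) *m c = 0 <-> forall d, fn c^T (f d) = fn c^T d.
Proof.
move=> finj; have pc d : (pull f *m c) (enum_rank (f d)) 0 = fn c^T d.
  rewrite mxE (bigD1 (enum_rank d)) //= !mxE !enum_rankK eqxx mul1r.
  rewrite big1 ?addr0 /fn ?mxE // => i id; rewrite !mxE enum_rankK.
  case: eqP => [/finj E|]; last by rewrite mul0r.
  by rewrite E enum_valK eqxx in id.
have cT d : fn c^T d = c (enum_rank d) 0 by rewrite /fn mxE.
rewrite mulmxBl mul1mx; split=> [/eqP|cf].
  by rewrite subr_eq0 => /eqP fc d; rewrite -[RHS]pc fc cT.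
apply/eqP; rewrite subr_eq0; apply/eqP/matrixP => i j; rewrite ord1.
have -> : i = enum_rank (f (finv f (enum_val i))) by rewrite f_finv // enum_valK.
by rewrite pc -cf cT.
Qed.

Lemma fconnect_inv f (X : T -> rat) d e :
  (forall d, X (f d) = X d) -> fconnect f d e -> X d = X e.
Proof.
move=> Xf /iter_findex <-; elim: (findex _ _ _) => //= k ->.
by rewrite Xf.
Qed.

(** Invariance under [f] means constancy on its orbits, and [pi] labels each orbit by its root. *)
Lemma rank_pull_sub1 f : injective f ->
  (\rank (pull f - 1%:M)%R + fcard f predT = n)%N.
Proof.
move=> finj; have fsym := fconnect_sym finj.
pose pi (i : 'I_n) : {d | froots f d} := exist _ (froot f (enum_val i)) (roots_root fsym _).
rewrite (_ : fcard f predT = #|{: {d | froots f d}}|); last first.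
  by rewrite card_sig; apply: eq_card => d; rewrite !inE andbT.
apply: (rank_fibers (pi := pi)) => [[d dr]|c].
  by exists (enum_rank d); apply: val_inj; rewrite /= enum_rankK; apply/eqP.
have cE i : c i 0 = fn c^T (enum_val i) by rewrite /fn mxE enum_valK.
split=> [/(colker_pull_sub1 _ finj) cf i j /(congr1 val)/= /(fingraph.rootP fsym) ij|cpi].
  by rewrite !cE; apply: fconnect_inv ij.
apply/(colker_pull_sub1 _ finj) => d; rewrite /fn !mxE; apply: cpi.
apply: val_inj => /=; rewrite !enum_rankK; apply/(fingraph.rootP fsym).
by rewrite fsym fconnect1.
Qed.

End Pullback.

(** * The rank of the intersection form and Euler's formula *)

Section Euler.
Local Open Scope ring_scope.
Variable G : embedded_graph.
Hypothesis Gconn : connected G.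
Notation D := (dart G).
Notation n := #|dart G|.
(** Antisymmetric functions form the row space of [A1], functions with zero sum
    at each vertex that of [S1], and functions constant on faces the kernel of
    [F1]. *)
Notation A1 := (pull (rev (e := G)) - 1%:M).
Notation S1 := (pull (sigma (G := G)) - 1%:M).
Notation F1 := (pull (face_next (G := G)) - 1%:M).
Notation Z := (A1 :&: S1)%MS.
Implicit Types (x X : D -> rat).

Lemma rev_inj : injective (rev (e := G)).
Proof. exact: inv_inj (@revK G). Qed.

Lemma face_next_inj : injective (face_next (G := G)).
Proof. by move=> d e /sigma_inj/rev_inj. Qed.

Lemma fcycle_rotation v : fcycle (sigma (G := G)) (rotation v).
Proof.
case Ev: (rotation v) (cycle_next (rotation_uniq v)) => [|d l] //=.
set f := next _; rewrite (@eq_in_path _ (mem (d :: l)) (frel (sigma (G := G))) (frel f)) //.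
  by move=> a b aP _; rewrite /= /f -Ev /sigma; move: aP; rewrite -Ev mem_rotation => /eqP ->.
apply/allP => e; rewrite -rcons_cons mem_rcons inE => /orP[/eqP->|//]; exact: mem_head.
Qed.

Lemma fconnect_sigma (d e : D) : fconnect (sigma (G := G)) d e = (tail d == tail e).
Proof.
have dd : d \in rotation (tail d) by rewrite mem_rotation.
by rewrite (fconnect_cycle (fcycle_rotation (tail d)) dd) mem_rotation eq_sym.
Qed.

Lemma sigma_inv_tail X d e :
  (forall d, X (sigma d) = X d) -> tail d = tail e -> X d = X e.
Proof.
by move=> Xs de; apply: (fconnect_inv Xs); rewrite fconnect_sigma de.
Qed.

(** In a connected graph [rev] and [sigma] act transitively on darts: a walk is followed by turning
    around vertices with [sigma] and crossing edges with [rev]. *)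
Lemma rev_sigma_inv_const X (d e : D) :
  (forall d, X (rev d) = X d) -> (forall d, X (sigma d) = X d) -> X d = X e.
Proof.
move=> Xr Xs; have /connectP[p pP pe] := Gconn.2 (tail d) (tail e).
elim: p d pP pe => [|w p IH] d /=; first by move=> _ /esym; apply: sigma_inv_tail.
case/andP=> /existsP[d' /andP[/eqP d'd /eqP d'w]] pP pe.
rewrite (sigma_inv_tail Xs (esym d'd)) -Xr; apply: IH; by rewrite d'w.
Qed.

Lemma sum_mul_sigma_inv x X :
  (forall v, \sum_(d | tail d == v) x d = 0) -> (forall d, X (sigma d) = X d) ->
  \sum_d x d * X d = 0.
Proof.
move=> x0 Xs; rewrite (partition_big tail predT) //= big1 // => v _.
case: (pickP [pred d : D | tail d == v]) => [e /eqP ev|no]; last by rewrite big_pred0.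
rewrite (eq_bigr (fun d => x d * X e)) => [|d /eqP dv].
  by rewrite -mulr_suml x0 mul0r.
by rewrite (sigma_inv_tail Xs (e := e)) // dv ev.
Qed.

Lemma sum_mul_rev_inv x X :
  (forall d, x (rev d) = - x d) -> (forall d, X (rev d) = X d) ->
  \sum_d x d * X d = 0.
Proof.
move=> xN Xr; set s := \sum_d _; suff : s = - s by lra.
rewrite {1}/s (reindex_inj rev_inj) -sumrN; apply: eq_bigr => d _.
by rewrite xN Xr mulNr.
Qed.

Lemma cycle_inP v : cycle_in [set: D] (fn v) <-> (v <= Z)%MS.
Proof.
rewrite sub_capmx; split=> [[vN v0 _]|/andP[/sub_pull_sub1[X vX] /sub_pull_sub1[Y vY]]].
  apply/andP; split.
    (* An antisymmetric function is its own potential for [rev], up to the factor -1/2. *)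
    apply/sub_pull_sub1; exists (fun d => - fn v d / 2%:R) => d.
    by rewrite vN; field.
  (* No potential for [sigma] is written down: by duality it suffices that [v] is orthogonal to all
     functions invariant under [sigma]. *)
  apply: submx_col_ker => c /(colker_pull_sub1 _ (@sigma_inj G)) cs.
  apply/matrixP => i j; rewrite !ord1 -[c]trmxK dot_vec mxE.
  by rewrite -[RHS](sum_mul_sigma_inv v0 cs); apply: eq_bigr => d _; rewrite mulrC.
split=> [d|u|d]; last by rewrite inE.
- by rewrite !vX revK; ring.
- rewrite -sum_rotation (eq_bigr _ (fun d _ => vY d)) sumrB.
  by rewrite (sum_rotation_sigma Y) subrr.
Qed.

(** The orbits of [sigma] account for all vertices exactly when no vertex is isolated. *)
Lemma rank_sigma : (forall v : vertex G, exists d, tail d = v) ->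
  (\rank S1%R + #|vertex G| = n)%N.
Proof.
move=> tailS.
apply: (rank_fibers (pi := fun i => tail (enum_val i))) => [v|c].
  by have [d <-] := tailS v; exists (enum_rank d); rewrite enum_rankK.
have cE i : c i 0 = fn c^T (enum_val i) by rewrite /fn mxE enum_valK.
split=> [/(colker_pull_sub1 _ (@sigma_inj G)) cf i j ij|cpi].
  by rewrite !cE; apply: sigma_inv_tail.
apply/(colker_pull_sub1 _ (@sigma_inj G)) => d; rewrite /fn !mxE; apply: cpi.
by rewrite !enum_rankK tail_sigma.
Qed.

(** By connectedness only constants are invariant under both [rev] and [sigma]; the dart [d0] makes
    them a space of dimension one. *)
Lemma rank_rev_sigma (d0 : D) : (\rank (A1 + S1)%MS + 1 = n)%N.
Proof.
rewrite (eqmx_rank (introT eqmxP (addsmxE A1 S1))) -card_unit.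
apply: (rank_fibers (pi := fun=> tt)) => [[]|c].
  by exists (enum_rank d0).
have cE i : c i 0 = fn c^T (enum_val i) by rewrite /fn mxE enum_valK.
rewrite mul_col_mx; split=> [|cc].
  rewrite -[0]col_mx0 => /eq_col_mx[/(colker_pull_sub1 _ rev_inj) cr].
  move=> /(colker_pull_sub1 _ (@sigma_inj G)) cs i j _.
  by rewrite !cE; apply: rev_sigma_inv_const.
rewrite -[RHS]col_mx0; congr col_mx.
  by apply/(colker_pull_sub1 _ rev_inj) => d; rewrite /fn !mxE; apply: cc.
by apply/(colker_pull_sub1 _ (@sigma_inj G)) => d; rewrite /fn !mxE; apply: cc.
Qed.

Lemma fcard_rev : (fcard (rev (e := G)) predT * 2 = n)%N.
Proof.
apply: (fcard_order_set rev_inj) => //.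
apply/subsetP => d _; rewrite inE; apply/eqP.
have rr : fcycle (rev (e := G)) [:: d; rev d] by rewrite /= revK !eqxx.
rewrite (order_cycle rr) ?mem_head //= inE andbT.
by rewrite eq_sym rev_neq.
Qed.

Lemma n_edgesE : n_edges G = fcard (rev (e := G)) predT.
Proof. by rewrite /n_edges -fcard_rev muln2 doubleK. Qed.

(** If [p] is constant on faces, then [p (sigma d) - p d = p (rev d) - p d], a combination of face
    boundaries. It vanishes only for constant [p], which costs one dimension. *)
Lemma rank_face_boundaries (d0 : D) :
  (\rank (kermx F1 *m S1)%R + 1 = fcard (face_next (G := G)) predT)%N.
Proof.
have := mxrank_mul_ker (kermx F1) S1.
rewrite mxrank_ker -[n in (n - _)%N](rank_pull_sub1 face_next_inj) addKn => <-.
congr (_ + _)%N; apply/esym.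
have /eqmx_rank-> : (kermx F1 :&: kermx S1 == (const_mx 1 : 'rV_n))%MS.
  apply/andP; split; last first.
    rewrite sub_capmx; apply/andP; split.
      by apply/sub_kermxP/ker_pull_sub1 => d; rewrite /fn !mxE.
    by apply/sub_kermxP/ker_pull_sub1 => d; rewrite /fn !mxE.
  apply/row_subP => i; move: (row_sub i (kermx F1 :&: kermx S1)%MS).
  move: (row i _) => u; rewrite sub_capmx.
  case/andP=> /sub_kermxP/ker_pull_sub1 uF /sub_kermxP/ker_pull_sub1 uS.
  have uR d : fn u (rev d) = fn u d by rewrite -uS -face_nextE uF.
  apply/submxP; exists (fn u d0)%:M; apply: fn_inj => d.
  rewrite mul_scalar_mx /fn !mxE mulr1 -!/(fn _ _).
  exact: rev_sigma_inv_const.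
rewrite rank_rV; apply/eqP; rewrite eqb1.
by apply/negP => /eqP/rowP/(_ (enum_rank d0)); rewrite !mxE => /eqP; rewrite oner_eq0.
Qed.

Notation Zbase := (row_base Z).
Notation pot := (Zbase *m pinvmx S1).
(** If [x d = X (sigma d) - X d], then [omega x y] is the sum of
    [y d * (X d + X (sigma d))]; [pot] lists such an [X] for each cycle of the
    basis. *)
Definition gram := pot *m (pull (sigma (G := G)) + 1%:M) *m Zbase^T.

Lemma potK : pot *m S1 = Zbase.
Proof. by rewrite mulmxKpV // eq_row_base capmxSr. Qed.

Lemma omega_dot (p y : 'rV[rat]_n) : (y <= Z)%MS ->
  omega (fn (p *m S1)) (fn y) = (p *m (pull (sigma (G := G)) + 1%:M) *m y^T) 0 0.
Proof.
move=> /cycle_inP yZ; rewrite (omega_potential (X := fn p) yZ) => [|d].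
  rewrite dot_vec; apply: eq_bigr => d _; congr (_ * _).
  by rewrite mulmxDr mulmx1 fnD fn_mul_pull addrC.
by rewrite mulmxBr mulmx1 fnB fn_mul_pull.
Qed.

Lemma omega_gram u v : omega (fn (u *m Zbase)) (fn (v *m Zbase)) = (u *m gram *m v^T) 0 0.
Proof.
rewrite -{1}potK mulmxA omega_dot; last by rewrite mulmx_sub // eq_row_base.
by rewrite trmx_mul !mulmxA.
Qed.

Lemma gram_tr : gram^T = - gram.
Proof.
apply/matrixP => i j.
have E k l : gram k l = omega (fn (row k 1%:M *m Zbase)) (fn (row l 1%:M *m Zbase)).
  by rewrite omega_gram tr_row -row_mul row_mul_col mul1mx trmx1 mulmx1.
by rewrite mxE [RHS]mxE !E omegaC.
Qed.

(** If [x] is in the radical, then [X + X \o sigma] is orthogonal to all cycles,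
    hence [s + t] with [s] invariant under [rev] and [t] under [sigma]; the
    potential [X - t / 2] of [x] is then constant on faces. *)
Lemma radical_eq : (kermx gram *m Zbase == kermx F1 *m S1)%MS.
Proof.
apply/andP; split; apply/row_subP => i; rewrite row_mul.
  have : row i (kermx gram) *m gram = 0 by rewrite -row_mul mulmx_ker row0.
  move: (row i _) => u ug; pose p := u *m pot.
  have pZ : p *m (pull (sigma (G := G)) + 1%:M) *m Zbase^T = 0.
    by rewrite -[RHS]ug /gram /p !mulmxA.
  have pE : p *m S1 = u *m Zbase by rewrite -mulmxA potK.
  set w := p *m (pull (sigma (G := G)) + 1%:M).
  have wE d : fn w d = fn p (sigma d) + fn p d.
    by rewrite /w mulmxDr mulmx1 fnD fn_mul_pull.
  have /sub_addsmxP[[a b] /= wab] : (w <= kermx A1^T + kermx S1^T)%MS.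
    apply: submx_col_ker => c Kc.
    have Kc0 m (K : 'M_(m, n)) : (K <= kermx A1^T + kermx S1^T)%MS -> K *m c = 0.
      by case/submxP=> B ->; rewrite -mulmxA Kc mulmx0.
    have : (c^T <= Z)%MS.
      by rewrite sub_capmx !sub_ker_tr ?Kc0 ?addsmxSl ?addsmxSr.
    rewrite -(eq_row_base Z) => /submxP[t /(congr1 trmx)]; rewrite trmxK => ->.
    by rewrite trmx_mul /w mulmxA pZ mul0mx.
  set s := a *m _ in wab; set t := b *m _ in wab.
  have sr d : fn s (rev d) = fn s d.
    rewrite -[s]trmxK; apply/(colker_pull_sub1 _ rev_inj): d.
    by apply: trmx_inj; rewrite trmx_mul trmxK trmx0 /s -mulmxA mulmx_ker mulmx0.
  have ts d : fn t (sigma d) = fn t d.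
    rewrite -[t]trmxK; apply/(colker_pull_sub1 _ (@sigma_inj G)): d.
    by apply: trmx_inj; rewrite trmx_mul trmxK trmx0 /t -mulmxA mulmx_ker mulmx0.
  have st d : fn p (sigma d) + fn p d = fn s d + fn t d by rewrite -wE wab fnD.
  have xN d : fn (p *m S1) (rev d) = - fn (p *m S1) d.
    suff /cycle_inP[-> //] : (p *m S1 <= Z)%MS.
    by rewrite pE mulmx_sub // eq_row_base.
  have xE d : fn (p *m S1) d = fn p (sigma d) - fn p d.
    by rewrite mulmxBr mulmx1 fnB fn_mul_pull.
  pose q := p - 2%:R^-1 *: t.
  have qE d : fn q d = fn p d - 2%:R^-1 * fn t d by rewrite fnB /fn !mxE.
  have -> : u *m Zbase = q *m S1.
    rewrite -pE mulmxBl -scalemxAl (_ : t *m S1 = 0) ?scaler0 ?subr0 //.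
    exact/ker_pull_sub1.
  apply: submxMr; apply/sub_kermxP/ker_pull_sub1 => d.
  rewrite face_nextE !qE ts.
  have := st d; have := st (rev d); have := xN d; rewrite !xE sr.
  lra.
(* Conversely, if [p] is constant on faces, then [p \o sigma = p \o rev]. So [p + p \o sigma] is
   invariant under [rev] and orthogonal to every cycle. *)
have : row i (kermx F1) *m F1 = 0 by rewrite -row_mul mulmx_ker row0.
move: (row i _) => p /ker_pull_sub1 pF.
have ps d : fn p (sigma d) = fn p (rev d) by rewrite -[d in LHS]revK -face_nextE pF.
have : (p *m S1 <= Z)%MS.
  rewrite sub_capmx submxMl andbT; apply/sub_pull_sub1; exists (fn p) => d.
  by rewrite mulmxBr mulmx1 fnB fn_mul_pull ps.
rewrite -(eq_row_base Z) => /submxP[t tE]; rewrite tE; apply: submxMr.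
apply/sub_kermxP/rowP => j; rewrite [RHS]mxE.
have -> : (t *m gram) 0 j = (t *m gram *m (row j 1%:M)^T) 0 0.
  by rewrite -[in RHS](row_id 0 (t *m gram)) tr_row row_mul_col trmx1 mulmx1.
have yZ : (row j 1%:M *m Zbase <= Z)%MS by rewrite mulmx_sub // eq_row_base.
rewrite -omega_gram -tE omega_dot // dot_vec.
have /cycle_inP[yN _ _] := yZ.
rewrite -[RHS](sum_mul_rev_inv (X := fun d => fn p (sigma d) + fn p d) yN) => [|d].
  by apply: eq_bigr => d _; rewrite mulmxDr mulmx1 fnD fn_mul_pull.
by rewrite !ps revK addrC.
Qed.

Lemma rank_gram (d0 : D) : (\rank gram + fcard (face_next (G := G)) predT = \rank Z + 1)%N.
Proof.
rewrite -(rank_face_boundaries d0) -(eqmx_rank radical_eq).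
rewrite mxrankMfree ?row_base_free // mxrank_ker addnA subnKC //.
exact: rank_leq_row.
Qed.

(** Dual families of size [k] factor the identity matrix through [gram], which bounds [k] by the
    rank; conversely, one-sided inverses of the factors of [gram] give dual families. *)
Lemma has_pairing_gram k : has_pairing [set: D] k <-> (k <= \rank gram)%N.
Proof.
split=> [[x [y [xZ yZ xy]]]|kr].
  have base (z : 'I_k -> D -> rat) : (forall i, cycle_in [set: D] (z i)) ->
      exists P, \matrix_i vec (z i) = P *m Zbase.
    move=> zZ; apply/submxP; rewrite eq_row_base; apply/row_subP => i.
    rewrite rowK; apply/cycle_inP; have [z1 z2 z3] := zZ i.
    split=> [d|v|d dD]; rewrite ?vecK //; last exact: z3.
    by rewrite -[RHS](z2 v); apply: eq_bigr => d _; rewrite vecK.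
  have [P PE] := base x xZ; have [Q QE] := base y yZ.
  have fnP (z : 'I_k -> D -> rat) R i : \matrix_i vec (z i) = R *m Zbase ->
      z i =1 fn (row i R *m Zbase).
    by move=> zR d; rewrite -row_mul -zR rowK vecK.
  have PQ : P *m gram *m Q^T = 1%:M.
    apply/matrixP => i j; rewrite [RHS]mxE -xy.
    rewrite /omega (eq_bigr _ (fun v _ => eq_wedge _ (fnP x P i PE) (fnP y Q j QE))).
    by rewrite -/(omega _ _) omega_gram tr_row -row_mul row_mul_col.
  by rewrite -[k in (k <= _)%N](mxrank1 rat) -PQ (leq_trans (mxrankM_maxl _ _)) ?mxrankM_maxr.
have [P [Q PQ]] : exists P Q, P *m gram *m Q = 1%:M :> 'M_(\rank gram).
  move: (col_base gram) (row_base gram) (col_base_full gram) (row_base_free gram)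
    (mulmx_base gram) => B C /row_fullP[P PB] /row_freeP[Q CQ] BC.
  exists P, Q; have <- := congr1 (fun M => P *m M *m Q) BC.
  by rewrite !mulmxA PB mul1mx CQ.
have cyc v : cycle_in [set: D] (fn (v *m Zbase)).
  by apply/cycle_inP; rewrite mulmx_sub // eq_row_base.
exists (fun i => fn (row (widen_ord kr i) P *m Zbase)).
exists (fun i => fn (row (widen_ord kr i) Q^T *m Zbase)); split=> // i j.
rewrite omega_gram tr_row trmxK.
by rewrite -row_mul row_mul_col PQ mxE.
Qed.

(** Here [r] is the rank of the form; comparison with [cellular_in] shows that it is twice the
    genus. *)
Theorem euler_pairing : exists r : nat,
  [/\ ~~ odd r, forall k, has_pairing [set: D] k <-> (k <= r)%N
    & (#|vertex G| + n_facial_walks G + r = n_edges G + 2)%N].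
Proof.
have [d0 _|noD] := pickP (fun d : D => true).
  have tailS v : exists d : D, tail d = v.
    have /connectP[[|w p] /= pP pe] := Gconn.2 v (tail d0); first by exists d0.
    by case/andP: pP => /existsP[d /andP[/eqP <- _]] _; exists d.
  exists (\rank gram); split; last 1 first.
  - rewrite /n_facial_walks [X in (_ + (_ + X))%N]eq_card0 => [|v]; last first.
      rewrite !inE; have [d <-] := tailS v; have : d \in rotation (tail d) by rewrite mem_rotation.
      by case: (rotation _).
    (* With [V] vertices and [E] edges, [A1] has rank [E], [S1] has rank [2E - V] and their sum has
       rank [2E - 1]. So the cycle space has dimension [E - V + 1], and [rank_gram] brings in the
       faces. *)
    have := mxrank_sum_cap A1 S1; have := rank_gram d0; have := rank_rev_sigma d0.
    have := rank_sigma tailS; have := rank_pull_sub1 rev_inj; have := fcard_rev.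
    rewrite n_edgesE; lia.
  - exact: antisym_rank_even gram_tr.
  - exact: has_pairing_gram.
(* Without darts the graph is a single isolated vertex with its trivial facial walk, and the formula
   reads [1 + 1 + 0 = 0 + 2]. *)
have D0 : #|D| = 0%N by apply: eq_card0.
have rot0 v : rotation v = [::] :> seq D.
  by case: (rotation v) => // d; have := noD d.
exists 0%N; split=> // [k|].
  rewrite leqn0; split=> [[x [y [_ _ xy]]]|/eqP->].
    case: k x y xy => // k x y /(_ ord0 ord0).
    rewrite eqxx /omega big1 => [/eqP|v _]; first by rewrite eq_sym oner_eq0.
    by rewrite rot0.
  by exists (fun _ _ => 0), (fun _ _ => 0); split; case.
have V1 : #|vertex G| = 1%N.
  case/card_gt0P: Gconn.1 => v _; rewrite -(card1 v); apply: eq_card => u.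
  rewrite !inE; have /connectP[[|w p] /= pP ->] := Gconn.2 u v; first by rewrite eqxx.
  by case/andP: pP => /existsP[d]; have := noD d.
have F0 : fcard (face_next (G := G)) predT = 0%N.
  by apply: eq_card0 => d; have := noD d.
have N1 : #|[pred v : vertex G | rotation v == [::]]| = 1%N.
  by rewrite -V1; apply: eq_card => v; rewrite !inE rot0.
by rewrite /n_facial_walks /n_edges D0 F0 N1 V1.
Qed.

End Euler.

(** * Passage between a subgraph and the ambient graph *)

Section Restriction.
Local Open Scope ring_scope.
Variables (M : embedded_graph) (S : subgraph M).
Implicit Types x y : dart M -> rat.

Definition restrict x : dart S -> rat := fun d => x (val d).
Definition extend (x : dart S -> rat) : dart M -> rat :=
  fun d => if insub d is Some e then x e else 0.

Lemma extendK (x : dart S -> rat) : restrict (extend x) =1 x.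
Proof. by move=> d; rewrite /restrict /extend valK. Qed.

Lemma extend_out (x : dart S -> rat) d : d \notin dset S -> extend x d = 0.
Proof. by move=> dS; rewrite /extend insubN. Qed.

Lemma tail_out v d : v \notin vset S -> tail d == v -> d \notin dset S.
Proof. by move=> vS /eqP dv; apply: contra vS => /tail_vset; rewrite dv. Qed.

Lemma omega_restrict x y :
  (forall d, d \notin dset S -> x d = 0) -> (forall d, d \notin dset S -> y d = 0) ->
  omega (restrict x) (restrict y) = omega x y.
Proof.
move=> x0 y0; rewrite /omega [RHS](bigID (mem (vset S))) /= [X in _ + X]big1.
  rewrite addr0 [RHS](reindex_omap (val : vertex S -> vertex M) insub) /=.
    apply: eq_big => [v|v _]; first by rewrite valK eqxx (valP v).
    exact: wedge_pmap_insub.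
  by move=> v vS; rewrite insubT.
move=> v vS; have : {in rotation v, x =1 fun=> 0} /\ {in rotation v, y =1 fun=> 0}.
  by split=> d; rewrite mem_rotation => /(tail_out vS)/=; [apply: x0|apply: y0].
elim: (rotation v) => //= d l IH [x0' y0'].
rewrite x0' ?mem_head // y0' ?mem_head // !mul0r subrr add0r IH //.
by split=> e el; [apply: x0'|apply: y0']; rewrite inE el orbT.
Qed.

Lemma cycle_in_restrict x : (forall d, d \notin dset S -> x d = 0) ->
  cycle_in [set: dart S] (restrict x) <-> cycle_in (dset S) x.
Proof.
move=> x0; have sumE (v : vertex S) : \sum_(d : dart S | tail d == v) restrict x d
    = \sum_(d | tail d == val v) x d.
  by rewrite -!sum_rotation; apply: sum_pmap_insub.
split=> [[xN xb _]|[xN xb _]]; split=> //.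
- move=> d; case dS: (d \in dset S); first exact: xN (exist _ d dS).
  rewrite !x0 ?oppr0 ?dS //; apply/negP => /rev_dset.
  by rewrite revK dS.
- move=> v; case vS: (v \in vset S); first by have := xb (exist _ v vS); rewrite sumE.
  by rewrite big1 // => d dv; rewrite x0 // (tail_out _ dv) ?vS.
- by move=> d; apply: xN.
- by move=> v; rewrite sumE.
- by move=> d; rewrite inE.
Qed.

Lemma has_pairing_restrict k : has_pairing [set: dart S] k <-> has_pairing (dset S) k.
Proof.
split=> [] [x [y [xZ yZ xy]]].
  exists (fun i => extend (x i)), (fun i => extend (y i)).
  have ext z : cycle_in [set: dart S] z -> cycle_in (dset S) (extend z).
    move=> zZ; apply/cycle_in_restrict; first exact: extend_out.
    (* The two functions agree only pointwise, so being a cycle is transferred through a linear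
       combination with one term. *)
    apply: (cycle_in_linear (fun i : 'I_1 => zZ) (a := fun=> 1)) => d.
    by rewrite big_ord1 mul1r extendK.
  split=> [i|i|i j]; try exact: ext.
  rewrite -omega_restrict; try exact: extend_out.
  rewrite -xy /omega; apply: eq_bigr => v _; apply: eq_wedge; exact: extendK.
exists (fun i => restrict (x i)), (fun i => restrict (y i)).
have supp z : cycle_in (dset S) z -> forall d, d \notin dset S -> z d = 0 by case.
split=> [i|i|i j]; try by apply/cycle_in_restrict => //; apply: supp.
by rewrite omega_restrict //; apply: supp.
Qed.

End Restriction.

(** * The genus as half the rank of the form *)

Section Genus.
Local Open Scope ring_scope.

(** Rotations correspond only up to a cyclic shift of the lists, to which [wedge] is insensitive on
    cycles. *)
Lemma has_pairing_isomorphic (G G' : embedded_graph) k : isomorphic G G' ->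
  has_pairing [set: dart G] k -> has_pairing [set: dart G'] k.
Proof.
case=> f [h [fbij [h' hK h'K] hf hr hrot]] [x [y [xZ yZ xy]]].
have hbij : bijective h by exists h'.
have finj := bij_inj fbij.
have cyc z : cycle_in [set: dart G] z -> cycle_in [set: dart G'] (z \o h').
  case=> zN zb _; split=> [d|v|d]; last by rewrite inE.
  - by rewrite -{1}[d]h'K hr /= hK zN.
  - have [f' fK f'K] := fbij; rewrite -[v]f'K -[RHS](zb (f' v)).
    rewrite (reindex h) /=; last exact: onW_bij.
    apply: eq_big => [d|d _]; last by rewrite hK.
    by rewrite hf (inj_eq finj).
exists (fun i => x i \o h'), (fun i => y i \o h'); split=> [i|i|i j]; try exact: cyc.
rewrite -xy /omega (reindex f) /=; last exact: onW_bij.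
apply: eq_bigr => v _; have [n ->] := hrot v.
have sum0 z : cycle_in [set: dart G] z ->
    \sum_(e <- map h (rotation v)) (z \o h') e = 0.
  case=> _ zb _; rewrite big_map -[RHS](zb v) -sum_rotation.
  by apply: eq_bigr => d _; rewrite /= hK.
rewrite wedge_rot ?sum0 // wedge_map; apply: eq_wedge => d; by rewrite /= hK.
Qed.

Lemma isomorphic_full (G : embedded_graph) : exists S : subgraph G, isomorphic G S.
Proof.
have fullP : is_subgraph ([set: vertex G], [set: dart G]).
  by apply/forall_inP => d _; rewrite !inE.
pose S := Subgraph fullP.
have vT v : v \in vset S by rewrite inE.
have dT d : d \in dset S by rewrite inE.
exists S, (fun v => exist _ v (vT v)), (fun d => exist _ d (dT d)); split.
- by exists val => [v|v] //; apply: val_inj.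
- by exists val => [v|v] //; apply: val_inj.
- by move=> d; apply: val_inj.
- by move=> d; apply: val_inj.
move=> v; exists 0%N; rewrite rot0 /= /sub_rotation /=.
elim: (rotation v) => //= d l <-; rewrite insubT ?dT //= => dS.
by congr (_ :: _); apply: val_inj.
Qed.

(** The rotation system itself realises genus [r./2]; smaller genera are excluded because the rank
    cannot decrease when passing to a larger graph. *)
Lemma genP (G : embedded_graph) : connected G ->
  exists2 r, ~~ odd r /\ gen G = r./2 & forall k, has_pairing [set: dart G] k <-> (k <= r)%N.
Proof.
move=> Gconn; have [r [reven rP rE]] := euler_pairing Gconn.
exists r => //; split=> //.
have emb : embeddable_in G r./2.
  have [S GS] := isomorphic_full G; exists G, S; split=> //; split=> //.
  by rewrite mul2n even_halfK.
have lb k : embeddable_in G k -> (r./2 <= k)%N.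
  case=> M [S [[Mconn Mk] GS]]; have [r' [_ r'P r'E]] := euler_pairing Mconn.
  have : (r <= r')%N.
    apply/r'P; apply: (has_pairingS (subsetT (dset S))).
    by apply/has_pairing_restrict/(has_pairing_isomorphic GS)/rP.
  lia.
(* A least genus exists, so [xget] returns it and not its default 0. *)
have [gemb gmin] := classical_sets.xgetPex 0%N (ex_intro (fun g : nat =>
  embeddable_in G g /\ forall k, embeddable_in G k -> (g <= k)%N) _ (conj emb lb)).
by apply/eqP; rewrite eqn_leq gmin //= lb.
Qed.

(** Both ranks are even, so halving them preserves strict inequality. *)
Lemma gen_lt_pairing (G G' : embedded_graph) : connected G -> connected G' ->
  (gen G < gen G')%N <->
  exists2 k, ~ has_pairing [set: dart G] k & has_pairing [set: dart G'] k.
Proof.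
move=> /genP[r [ev ->] rP] /genP[r' [ev' ->] r'P]; split=> [lt|[k /rP kr /r'P kr']].
  by exists r'; [rewrite rP; lia|apply/r'P].
lia.
Qed.

End Genus.

(** * Unions of members and generators of their cycles *)

Section Clusters.
Local Open Scope ring_scope.
Variable M : embedded_graph.
Implicit Types (A B H S : subgraph M) (F : {set subgraph M}) (x y z : dart M -> rat).

Lemma dset_union F A : A \in F -> dset A \subset dset (union_subgraph F).
Proof. by move=> AF; apply: (bigcup_sup A). Qed.

Lemma vset_union F A : A \in F -> vset A \subset vset (union_subgraph F).
Proof. by move=> AF; apply: (bigcup_sup A). Qed.

Lemma connect_sub S S' (u v : vertex S') :
  vset S \subset vset S' -> dset S \subset dset S' -> connected S ->
  val u \in vset S -> val v \in vset S -> connect (@adjacent S') u v.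
Proof.
move=> /subsetP vSS' /subsetP dSS' [_ Sconn] uS vS.
have /connectP[p] := Sconn (exist _ (val u) uS) (exist _ (val v) vS).
elim: p u uS => [|w p IH] u uS /=.
  by move=> _ /(congr1 val)/= /val_inj ->.
case/andP=> /existsP[d /andP[/eqP du /eqP dw]] pP pv.
pose w' : vertex S' := exist _ (val w) (vSS' _ (valP w)).
apply: (@connect_trans _ _ w'); last first.
  apply: (IH w' (valP w)); first by move: pP; rewrite (_ : exist _ _ _ = w) //; apply: val_inj.
  by rewrite pv; congr (last _ p); apply: val_inj.
apply: connect1; apply/existsP; exists (exist _ (val d) (dSS' _ (valP d))).
by rewrite -!val_eqE /= -[tail _]/(val (tail d)) du -[tail _]/(val (tail (rev d))) dw !eqxx.
Qed.

(** Every vertex reaches [H] inside a member that contains it, and [H] itself is connected. *)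
Lemma connected_union F H : H \in F -> (forall A, A \in F -> connected A) ->
  (forall A, A \in F -> vset H :&: vset A != set0) -> connected (union_subgraph F).
Proof.
move=> HF Fconn HA; split.
  have /set0Pn[v /setIP[vH _]] := HA H HF.
  apply/card_gt0P; exists (exist _ v (subsetP (vset_union HF) v vH)) => //.
pose U := union_subgraph F.
have toH (u : vertex U) : exists2 w : vertex U, val w \in vset H &
    connect (@adjacent U) u w /\ connect (@adjacent U) w u.
  have /bigcupP[A AF uA] := valP u; have /set0Pn[w /setIP[wH wA]] := HA A AF.
  pose w' : vertex U := exist _ w (subsetP (vset_union HF) w wH).
  have cA a b := @connect_sub A U a b (vset_union AF) (dset_union AF) (Fconn A AF).
  by exists w' => //; split; apply: cA.
move=> u v; have [u' u'H [uu' _]] := toH u; have [v' v'H [_ v'v]] := toH v.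
apply: connect_trans uu' (connect_trans _ v'v).
exact: connect_sub (vset_union HF) (dset_union HF) (Fconn H HF) u'H v'H.
Qed.

Lemma dset_unionS F F' : F \subset F' ->
  dset (union_subgraph F) \subset dset (union_subgraph F').
Proof.
move=> /subsetP FF'; apply/bigcupsP => A /FF'; exact: dset_union.
Qed.

Lemma sum_delta (P : pred (dart M)) d :
  \sum_(e | P e) (e == d)%:R = (P d)%:R :> rat.
Proof.
case Pd: (P d); last by rewrite big1 // => e Pe; case: eqP Pe => // ->; rewrite Pd.
rewrite (bigD1 d) //= eqxx big1 ?addr0 // => e /andP[_ /negPf-> //].
Qed.

Definition edge_chain (d e : dart M) : rat := (e == d)%:R - (e == rev d)%:R.

Lemma edge_chain_rev d e : edge_chain d (rev e) = - edge_chain d e.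
Proof. by rewrite /edge_chain !(inv_eq (@revK M)) revK opprB. Qed.

Lemma edge_chain_out S d e : d \in dset S -> e \notin dset S -> edge_chain d e = 0.
Proof.
move=> dS eS; rewrite /edge_chain; have := rev_dset dS.
case: eqP eS => [->|_]; first by rewrite dS.
by case: eqP => [->|_ _ _]; [move=> /negPf->|rewrite subrr].
Qed.

Lemma edge_chain_boundary d w :
  \sum_(e | tail e == w) edge_chain d e = (tail d == w)%:R - (tail (rev d) == w)%:R.
Proof. by rewrite sumrB !sum_delta. Qed.

(** The chain is the sum of the edges of a walk in [S]. Darts count positively at their tails,
    whence the sign of the boundary. *)
Lemma path_chain S u v : connected S -> u \in vset S -> v \in vset S ->
  exists p : dart M -> rat,
    [/\ forall d, p (rev d) = - p d, forall d, d \notin dset S -> p d = 0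
      & forall w, \sum_(d | tail d == w) p d = (u == w)%:R - (v == w)%:R].
Proof.
move=> [_ Sconn] uS vS.
have /connectP[p] := Sconn (exist _ u uS) (exist _ v vS).
elim: p u uS => [|w p IH] u uS /=.
  move=> _ /(congr1 val)/= ->; exists (fun=> 0); split=> // w.
  by rewrite big1 // subrr.
case/andP=> /existsP[d /andP[/eqP du /eqP dw]] pP pv.
have := IH (val w) (valP w); have -> : exist _ (val w) (valP w) = w by apply: val_inj.
case=> // q [qN q0 qb].
exists (fun e => edge_chain (val d) e + q e); split=> [e|e eS|x].
- by rewrite edge_chain_rev qN -opprD.
- by rewrite /= (edge_chain_out (valP d)) // q0 // addr0.
rewrite big_split /= edge_chain_boundary qb.
have -> : tail (val d) = u by rewrite -[LHS]/(val (tail d)) du.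
have -> : tail (rev (val d)) = val w by rewrite -[LHS]/(val (tail (rev d))) dw.
by rewrite addrA subrK.
Qed.

Lemma cycle_span F H z :
  H \in F -> (forall A, A \in F -> connected A) ->
  (forall A, A \in F -> vset H :&: vset A != set0) ->
  cycle_in (dset (union_subgraph F)) z ->
  exists (I : finType) (a : I -> rat) (g : I -> dart M -> rat),
    (forall i, exists A B, [/\ A \in F, B \in F &
      cycle_in (dset (union_subgraph [set H; A; B])) (g i)]) /\
    forall d, z d = \sum_i a i * g i d.
Proof.
move=> HF Fconn HA [zN zb z0].
have /set0Pn[r /setIP[rH _]] := HA H HF.
have HAconn A : A \in F -> connected (union_subgraph [set H; A]).
  move=> AF; apply: (@connected_union _ H); first exact: set21.
    by move=> B; rewrite !inE => /orP[]/eqP->; apply: Fconn.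
  by move=> B; rewrite !inE => /orP[]/eqP->; apply: HA.
(* For a vertex [u] of a member [A], the chain [p (A, u)] leads from [u] to the base point [r]
   inside the union of [H] and [A]. *)
have /fin_all_exists[p pP] : forall q : subgraph M * vertex M,
    exists c : dart M -> rat, q.1 \in F -> q.2 \in vset q.1 ->
    [/\ forall d, c (rev d) = - c d,
        forall d, d \notin dset (union_subgraph [set H; q.1]) -> c d = 0
      & forall w, \sum_(d | tail d == w) c d = (q.2 == w)%:R - (r == w)%:R].
  case=> A u /=.
  case AF: (A \in F); last by exists (fun=> 0).
  case uA: (u \in vset A); last by exists (fun=> 0).
  have uS := subsetP (vset_union (set22 H A)) u uA.
  have rS := subsetP (vset_union (set21 H A)) r rH.
  by have [c cP] := path_chain (HAconn A AF) uS rS; exists c.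
(* A choice of a member through each dart, the same for both darts of an edge, and of a member
   through each vertex; [H] is the default outside the union. *)
pose A d := odflt H [pick A in F | d \in dset A].
pose m v := odflt H [pick A in F | v \in vset A].
have AF d : A d \in F by rewrite /A; case: pickP => [B /andP[]|].
have Arev d : A (rev d) = A d.
  rewrite /A; congr odflt; apply: eq_pick => B; congr (_ && _).
  by apply/idP/idP => /rev_dset; rewrite ?revK.
have dA d : d \in dset (union_subgraph F) -> d \in dset (A d).
  case/bigcupP=> B BF dB; rewrite /A; case: pickP => [C /andP[] //|/(_ B)].
  by rewrite BF dB.
have mF v : m v \in F by rewrite /m; case: pickP => [B /andP[]|].
have vm v : v \in vset (union_subgraph F) -> v \in vset (m v).
  case/bigcupP=> B BF vB; rewrite /m; case: pickP => [C /andP[] //|/(_ B)].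
  by rewrite BF vB.
(* With [A (rev d) = A d] and coefficients [z d / 2] and [z d], the [t1 d]
   and [t2 d] sum to [z], up to paths that cancel because [z] is a cycle. *)
pose t1 d e := edge_chain d e - p (A d, tail d) e + p (A d, tail (rev d)) e.
pose t2 d e := p (A d, tail d) e - p (m (tail d), tail d) e.
pose U := dset (union_subgraph F).
exists (dart M + dart M)%type, (fun i => match i with inl d => z d / 2%:R | inr d => z d end).
(* Outside [U] the paths need not exist, so the generator is zero there; this is harmless since [z]
   vanishes on such darts. *)
exists (fun i => match i with
  | inl d => if d \in U then t1 d else fun=> 0
  | inr d => if d \in U then t2 d else fun=> 0 end).
have zero D : cycle_in D (fun=> 0).
  by split=> // v; rewrite big1.
split=> [[d|d]|e].
- exists (A d), (A d); split=> //; case: ifP => // dU.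
  have sub := dset_unionS (subsetUl [set H; A d] [set A d]).
  have [pN p0 pb] := pP (A d, tail d) (AF d) (tail_vset (dA d dU)).
  have [qN q0 qb] := pP (A d, tail (rev d)) (AF d) (tail_vset (rev_dset (dA d dU))).
  split=> [e|v|e eD].
  + by rewrite /t1 edge_chain_rev pN qN; ring.
  + by rewrite /t1 big_split sumrB /= pb qb edge_chain_boundary /=; ring.
  have eD' : e \notin dset (union_subgraph [set H; A d]) by apply: contra eD; apply: subsetP.
  rewrite /t1 p0 // q0 // (edge_chain_out _ eD') ?subrr ?addr0 //.
  exact: subsetP (dset_union (set22 H (A d))) d (dA d dU).
- exists (A d), (m (tail d)); split=> //; case: ifP => // dU.
  have [pN p0 pb] := pP (A d, tail d) (AF d) (tail_vset (dA d dU)).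
  have [qN q0 qb] := pP (m (tail d), tail d) (mF _) (vm _ (tail_vset dU)).
  split=> [e|v|e eD].
  + by rewrite /t2 pN qN; ring.
  + by rewrite /t2 sumrB pb qb /= subrr.
  rewrite /t2 p0 ?q0 ?subrr //; apply: contra eD; apply/subsetP/dset_unionS.
    by apply/subsetP => B; rewrite !inE => /orP[]->; rewrite ?orbT.
  exact: subsetUl.
rewrite big_sumType /=.
have zU (t : dart M -> dart M -> rat) (c : rat) :
    \sum_d z d * c * (if d \in U then t d else fun=> 0) e = c * \sum_d z d * t d e.
  rewrite mulr_sumr; apply: eq_bigr => d _; case: ifP => [_|dU]; first by ring.
  by rewrite z0 ?dU //; ring.
rewrite zU.
have -> : \sum_d z d * (if d \in U then t2 d else fun=> 0) e = \sum_d z d * t2 d e.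
  by rewrite -[RHS]mul1r -zU; apply: eq_bigr => d _; rewrite mulr1.
(* Each edge is counted once for each of its two darts, which explains the coefficient [z d / 2]. *)
have E1 : \sum_d z d * edge_chain d e = 2%:R * z e.
  rewrite (eq_bigr (fun d => z d * (d == e)%:R - z d * (rev d == e)%:R)) => [|d _].
    rewrite sumrB; have ze (f : dart M -> dart M) : injective f -> involutive f ->
        \sum_d z d * (f d == e)%:R = z (f e).
      move=> _ fK; rewrite (bigD1 (f e)) //= fK eqxx mulr1 big1 ?addr0 // => d.
      by rewrite -(inv_eq fK) => /negPf->; rewrite mulr0.
    rewrite (ze id) // (ze (rev (e := M))) //; last 2 first.
      exact: inv_inj (@revK M).
      exact: revK.
    by rewrite zN; ring.
  by rewrite /edge_chain mulrBr ![e == _]eq_sym.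
(* Reversing [d] exchanges its ends, keeps [A d] and negates [z d]. *)
have E2 : \sum_d z d * p (A d, tail (rev d)) e = - \sum_d z d * p (A d, tail d) e.
  rewrite (reindex_inj (inv_inj (@revK M))) -sumrN; apply: eq_bigr => d _.
  by rewrite zN revK Arev mulNr.
(* The path chosen by [m] depends only on the tail, and [z] sums to zero over the darts leaving a
   vertex. *)
have E3 : \sum_d z d * p (m (tail d), tail d) e = 0.
  rewrite (partition_big tail predT) //= big1 // => v _.
  rewrite (eq_bigr (fun d => z d * p (m v, v) e)) => [|d /eqP-> //].
  by rewrite -mulr_suml zb mul0r.
have -> : \sum_d z d * t1 d e = \sum_d z d * edge_chain d e
    - \sum_d z d * p (A d, tail d) e + \sum_d z d * p (A d, tail (rev d)) e.
  by rewrite -sumrB -big_split; apply: eq_bigr => d _; rewrite /t1 /=; ring.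
have -> : \sum_d z d * t2 d e = \sum_d z d * p (A d, tail d) e
    - \sum_d z d * p (m (tail d), tail d) e.
  by rewrite -sumrB; apply: eq_bigr => d _; rewrite /t2; ring.
by rewrite E1 E2 E3; field.
Qed.

End Clusters.

(** * Enlarging a pairing by one dual pair *)

Section Defect.
Local Open Scope ring_scope.
Variables (G : embedded_graph) (k : nat) (x y : 'I_k -> dart G -> rat).
Implicit Types (z : dart G -> rat) (E : {set dart G}).

(** The form [omega] on the components of [z] and [z'] orthogonal to the [y i]
    and to the [x i] respectively. *)
Definition defect z z' := omega z z' - \sum_i omega z (y i) * omega (x i) z'.

Lemma defect_linear_eq0 (I : finType) (a : I -> rat) (g : I -> dart G -> rat) z z' :
  (forall d, z d = \sum_i a i * g i d) -> (forall i, defect (g i) z' = 0) ->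
  defect z z' = 0.
Proof.
move=> zE g0; have gE i := subr0_eq (g0 i).
apply/eqP; rewrite subr_eq0 (omega_linear z' zE); apply/eqP.
under eq_bigr => i _ do rewrite gE mulr_sumr.
rewrite exchange_big; apply: eq_bigr => l _; rewrite (omega_linear (y l) zE) mulr_suml.
by apply: eq_bigr => i _; rewrite mulrA.
Qed.

Lemma defect_linear_r_eq0 (I : finType) (a : I -> rat) (g : I -> dart G -> rat) z z' :
  (forall d, z' d = \sum_i a i * g i d) -> (forall i, defect z (g i) = 0) ->
  defect z z' = 0.
Proof.
move=> zE g0; have gE i := subr0_eq (g0 i).
apply/eqP; rewrite subr_eq0 (omega_linear_r z zE); apply/eqP.
under eq_bigr => i _ do rewrite gE mulr_sumr.
rewrite exchange_big; apply: eq_bigr => l _; rewrite (omega_linear_r (x l) zE) mulr_sumr.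
by apply: eq_bigr => i _; rewrite mulrCA.
Qed.

Lemma omega_sub_comb (a : 'I_k -> rat) (g : 'I_k -> dart G -> rat) z t w :
  (forall d, t d = z d - \sum_i a i * g i d) ->
  omega t w = omega z w - \sum_i a i * omega (g i) w.
Proof.
(* The difference is treated as a linear combination indexed by [bool], with coefficients 1 and
   -1. *)
move=> tE; pose h (b : bool) d := if b then z d else \sum_i a i * g i d.
rewrite (omega_linear (a := fun b : bool => if b then 1 else -1) (x := h)).
  by rewrite big_bool /= mul1r mulN1r (omega_linear w (z := h false) (fun=> erefl)).
by move=> d; rewrite big_bool tE /= mul1r mulN1r.
Qed.

Lemma cycle_in_sub_comb E (a : 'I_k -> rat) (g : 'I_k -> dart G -> rat) z t :
  cycle_in E z -> (forall i, cycle_in E (g i)) ->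
  (forall d, t d = z d - \sum_i a i * g i d) -> cycle_in E t.
Proof.
move=> zZ gZ tE; pose h (b : bool) d := if b then z d else \sum_i a i * g i d.
apply: (cycle_in_linear (a := fun b : bool => if b then 1 else -1) (x := h)).
  by case=> //; apply: (cycle_in_linear gZ (a := a)).
by move=> d; rewrite big_bool tE /= mul1r mulN1r.
Qed.

Hypothesis xy : forall i j, omega (x i) (y j) = (i == j)%:R.

(** A Gram-Schmidt step: subtracting their components along the [x i] and the [y i] makes [z] and
    [z'] orthogonal to the given families, and their pairing becomes the defect, which is then
    scaled to 1. *)
Lemma has_pairing_extend E z z' :
  (forall i, cycle_in E (x i)) -> (forall i, cycle_in E (y i)) ->
  cycle_in E z -> cycle_in E z' -> defect z z' != 0 -> has_pairing E k.+1.
Proof.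
move=> xZ yZ zZ zZ' c0; set c := defect z z' in c0.
pose t d := z d - \sum_i omega z (y i) * x i d.
pose t' d := z' d - \sum_i omega (x i) z' * y i d.
have tE w : omega t w = omega z w - \sum_i omega z (y i) * omega (x i) w.
  exact: omega_sub_comb.
have t'E w : omega w t' = omega w z' - \sum_i omega (x i) z' * omega w (y i).
  rewrite omegaC (omega_sub_comb (a := fun i => omega (x i) z') (g := y) (z := z')) //.
  rewrite opprB addrC (omegaC z' w); congr (_ + _); rewrite -sumrN.
  by apply: eq_bigr => i _; rewrite (omegaC (y i) w) mulrN opprK.
have ty j : omega t (y j) = 0.
  rewrite tE (bigD1 j) //= xy eqxx mulr1 big1 ?addr0 ?subrr // => i /negPf ij.
  by rewrite xy ij mulr0.
have xt j : omega (x j) t' = 0.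
  rewrite t'E (bigD1 j) //= xy eqxx mulr1 big1 ?addr0 ?subrr // => i ij.
  by rewrite xy eq_sym (negPf ij) mulr0.
have tt : omega t t' = c.
  by rewrite t'E big1 ?subr0 ?tE // => i _; rewrite ty mulr0.
pose u d := c^-1 * t' d.
have uE w : omega w u = c^-1 * omega w t'.
  rewrite (omega_linear_r w (I := 'I_1) (a := fun=> c^-1) (x := fun=> t')).
    by rewrite big_ord1.
  by move=> d; rewrite big_ord1.
have tZ : cycle_in E t by apply: cycle_in_sub_comb zZ xZ _.
have t'Z : cycle_in E t' by apply: cycle_in_sub_comb zZ' yZ _.
have uZ : cycle_in E u.
  apply: (cycle_in_linear (I := 'I_1) (a := fun=> c^-1) (x := fun=> t')) => // d.
  by rewrite big_ord1.
(* The new pair takes the last index, and the old ones keep theirs. *)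
exists (fun i => if unlift ord_max i is Some j then x j else t).
exists (fun i => if unlift ord_max i is Some j then y j else u).
split=> [i|i|i j]; try by case: unliftP.
case: unliftP => [i'|] ->; case: unliftP => [j'|] ->.
- by rewrite xy (inj_eq (@lift_inj _ _)).
- by rewrite uE xt mulr0 eq_sym (negPf (neq_lift _ _)).
- by rewrite ty (negPf (neq_lift _ _)).
- by rewrite uE tt mulVf // eqxx.
Qed.

End Defect.

(** * Reduction to at most five members *)

Lemma card_set5_le (T : finType) (a b c d e : T) : #|[set a; b; c; d; e]| <= 5.
Proof.
have setU1r (A : {set T}) f m : #|A| <= m -> #|A :|: [set f]| <= m.+1.
  move=> Am; apply: leq_trans (leq_card_setU _ _) _.
  by rewrite cards1 addn1.
by rewrite (setU1r _ _ 4) ?(setU1r _ _ 3) ?(setU1r _ _ 2) ?(setU1r _ _ 1) ?cards1.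
Qed.

Lemma set3_sub_set5 (T : finType) (a b c d e : T) :
  [set a; d; e] \subset [set a; b; c; d; e].
Proof. by rewrite !subUset !sub1set !inE !eqxx ?orbT. Qed.

Theorem theorem2 (M : embedded_graph) (HH : {set subgraph M}) (H : subgraph M)
    (HH_cluster : is_cluster HH) (H_anchor : is_anchor HH H)
    (gen_lt : gen H < gen (union_subgraph HH)) :
  exists HH' : {set subgraph M},
    [/\ HH' \subset HH, H \in HH', #|HH'| <= 5 & gen H < gen (union_subgraph HH')].
Proof.
case: HH_cluster => conn _ _; case: H_anchor => HHH HA.
pose good (F : {set subgraph M}) :=
  [&& F \subset HH, H \in F, #|F| <= 5 & gen H < gen (union_subgraph F)].
have [/existsP[F /and4P FP]|none] := boolP [exists F, good F]; first by exists F.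
exfalso.
have connU (F : {set subgraph M}) : F \subset HH -> H \in F -> connected (union_subgraph F).
  move=> /subsetP FHH HF; apply: (connected_union HF) => A /FHH; [exact: conn|exact: HA].
have [r _ rP] := genP (conn H HHH).
(* If no admissible subfamily raises the genus, then none of them reaches rank [r + 1], where [r] is
   the rank on [H]. *)
have small (F : {set subgraph M}) : F \subset HH -> H \in F -> #|F| <= 5 ->
    ~ has_pairing (dset (union_subgraph F)) r.+1.
  move=> FHH HF F5 /has_pairing_restrict pF; move/existsP: none; apply; exists F.
  rewrite /good FHH HF F5 /=; apply/(gen_lt_pairing (conn H HHH) (connU F FHH HF)).
  by exists r.+1 => //; rewrite rP ltnn.
have [x [y [xZ yZ xy]]] : has_pairing (dset H) r by apply/has_pairing_restrict/rP.
(* Two generators together involve [H] and at most four other members; a nonzero defect would extend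
   the pairing of [H] to size [r + 1] on these. *)
have generators_defect A B A' B' g g' : A \in HH -> B \in HH -> A' \in HH -> B' \in HH ->
    cycle_in (dset (union_subgraph [set H; A; B])) g ->
    cycle_in (dset (union_subgraph [set H; A'; B'])) g' -> defect x y g g' = 0%R.
  move=> AF BF AF' BF' gZ gZ'; apply/eqP/negPn/negP => d0.
  have HF : H \in [set H; A; B; A'; B'] by rewrite !inE eqxx.
  apply: (small [set H; A; B; A'; B']); [| exact: HF | |].
  - by rewrite !subUset !sub1set HHH AF BF AF' BF'.
  - exact: card_set5_le.
  apply: (has_pairing_extend xy) d0 => [i|i||].
  - exact: cycle_inS (dset_union HF) (xZ i).
  - exact: cycle_inS (dset_union HF) (yZ i).
  - apply: cycle_inS gZ; apply: dset_unionS.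
    exact: subset_trans (subsetUl _ _) (subsetUl _ _).
  - apply: cycle_inS gZ'; apply: dset_unionS.
    exact: set3_sub_set5.
have defect0 z z' : cycle_in (dset (union_subgraph HH)) z ->
    cycle_in (dset (union_subgraph HH)) z' -> defect x y z z' = 0%R.
  move=> /(cycle_span HHH conn HA)[I [a [g [gP zE]]]].
  move=> /(cycle_span HHH conn HA)[J [b [h [hP zE']]]].
  apply: (defect_linear_eq0 zE) => i; apply: (defect_linear_r_eq0 zE') => j.
  have [A [B [AF BF gZ]]] := gP i; have [A' [B' [AF' BF' hZ]]] := hP j.
  exact: generators_defect gZ hZ.
have [k kH] := (gen_lt_pairing (conn H HHH) (connU HH (subxx _) HHH)).1 gen_lt.
move=> /has_pairing_restrict[X [Y [XZ YZ XY]]]; apply/kH/rP.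
(* Zero defect means that [omega] on the union factors through the [r] pairs of [H]: the identity
   matrix of size [k] becomes [P *m Q] with inner dimension [r], so [k <= r]. *)
pose P := (\matrix_(i < k, l < r) omega (X i) (y l))%R.
pose Q := (\matrix_(l < r, j < k) omega (x l) (Y j))%R.
have PQ : (P *m Q = 1%:M)%R.
  apply/matrixP => i j; rewrite !mxE -XY (subr0_eq (defect0 _ _ (XZ i) (YZ j))).
  by apply: eq_bigr => l _; rewrite !mxE.
rewrite -[k in k <= _](mxrank1 rat) -PQ.
exact: leq_trans (mxrankM_maxl _ _) (rank_leq_col _).
Qed.
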